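(* For every $\epsilon\in(0,1/2)$, \[ \mathsf{PostR}_\epsilon(MAJ_N)\geq \frac{N}{2}\left(1-\sqrt{\frac{\epsilon}{1-\epsilon}}\,\bigl(1+o(1)\bigr)\right), \] where $o(1)$ denotes a term tending to $0$ as $N\to\infty$.
   Context: $MAJ_N:\{0,1\}^N\rightarrow\{0,1\}$ is defined by $MAJ_N(x)=1$ if $|x|>N/2$ and $0$ if $|x|\le N/2$, where $|x|$ is the Hamming weight. $\mathsf{PostR}_\epsilon(f)$ is the minimum query complexity (maximum depth of a tree in the support) of a probability distribution $\mathcal{A}$ over deterministic decision trees with leaves labelled $0$, $1$ or $\perp$, chosen independently of the input, such that for every input $x$, $\Pr[\mathcal{A}(x)\neq\perp]>0$ and $\Pr[\mathcal{A}(x)=f(x)\mid\mathcal{A}(x)\neq\perp]\ge1-\epsilon$. *)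

(* Defs.v *)
From HB Require Import structures.
From mathcomp Require Import all_boot all_order all_algebra.
From mathcomp Require Import all_classical all_reals all_analysis.
Set Implicit Arguments.
Unset Strict Implicit.
Unset Printing Implicit Defensive.
Import Order.TTheory GRing.Theory Num.Theory.
Import numFieldNormedType.Exports.
Local Open Scope classical_set_scope.
Local Open Scope ring_scope.

Definition cube (N : nat) := {ffun 'I_N -> bool}.

Definition hamming_weight (N : nat) (x : cube N) : nat := #|[set i | x i]%SET|.

(* |x| > N/2, cleared of the fraction *)
Definition MAJ (N : nat) (x : cube N) : bool := (N < 2 * hamming_weight x)%N.

(* [Query i t0 t1] continues with [t0] if bit [i] is 0 and with [t1] if it is 1.
   A leaf labelled [None] outputs the undetermined answer (bottom). *)
Inductive dtree (N : nat) : Type :=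
| Answer of option bool
| Query of 'I_N & dtree N & dtree N.

Arguments Answer {N}.

Fixpoint output (N : nat) (t : dtree N) (x : cube N) : option bool :=
  match t with
  | Answer o => o
  | Query i t0 t1 => if x i then output t1 x else output t0 x
  end.

Fixpoint depth (N : nat) (t : dtree N) : nat :=
  match t with
  | Answer _ => 0
  | Query _ t0 t1 => (maxn (depth t0) (depth t1)).+1
  end.

Section DtreeCountable.
Variable N : nat.

Fixpoint dtree_encode (t : dtree N) : GenTree.tree (option bool) :=
  match t with
  | Answer o => GenTree.Leaf o
  | Query i t0 t1 =>
      GenTree.Node (nat_of_ord i) [:: dtree_encode t0; dtree_encode t1]
  end.

Fixpoint dtree_decode (t : GenTree.tree (option bool)) : option (dtree N) :=
  match t with
  | GenTree.Leaf o => Some (Answer o)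
  | GenTree.Node k [:: u0; u1] =>
      match insub k, dtree_decode u0, dtree_decode u1 with
      | Some i, Some t0, Some t1 => Some (Query i t0 t1)
      | _, _, _ => None
      end
  | _ => None
  end.

Lemma dtree_encodeK : pcancel dtree_encode dtree_decode.
Proof. by elim=> [//|i t0 /= IH0 t1 IH1] /=; rewrite valK IH0 IH1. Qed.

HB.instance Definition _ := Countable.copy (dtree N) (pcan_type dtree_encodeK).
HB.instance Definition _ := isPointed.Build (dtree N) (Answer None).

(* The discrete sigma-algebra: [dtree N] is countable, so a probability on it
   is the same thing as a family of point masses summing to 1. *)
HB.instance Definition _ := @isMeasurable.Build default_measure_display
  (dtree N) discrete_measurable discrete_measurable0
  discrete_measurableC discrete_measurableU.

End DtreeCountable.

Definition randomized_dtree (R : realType) (N : nat) : Type :=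
  probability (dtree N) R.

Section PostSelection.
Context {R : realType} {N : nat}.
Implicit Types (A : randomized_dtree R N) (f : cube N -> bool) (eps : R).

Definition support A : set (dtree N) := [set t | (0 < A [set t])%E].

(* +oo if the depths in the support are unbounded *)
Definition query_complexity A : \bar R :=
  ereal_sup [set (depth t)%:R%:E | t in support A].

(* Only used for events [F] of positive probability. *)
Definition cond_prob A (E F : set (dtree N)) : R :=
  fine (A (E `&` F)) / fine (A F).

Definition post_computes eps f A : Prop :=
  forall x : cube N,
    let answered := [set t : dtree N | output t x <> None] in
    let correct := [set t : dtree N | output t x = Some (f x)] in
    (0 < A answered)%E /\ 1 - eps <= cond_prob A correct answered.

(* The infimum of the empty set is +oo; for [0 <= eps] the infimum is a
   minimum, see [PostR_min]. *)
Definition PostR eps f : \bar R :=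
  ereal_inf [set query_complexity A | A in post_computes eps f].

Lemma support_neq0 A : support A !=set0.
Proof.
apply/set0P/eqP => supp0.
have null (n : nat) : A [set t : dtree N | unpickle n = Some t] = 0%E.
  case E : (unpickle n) => [t|]; last first.
    by rewrite (_ : [set _ | _] = set0) ?measure0 //; apply/seteqP; split.
  rewrite (_ : [set _ | _] = [set t]); last first.
    by apply/seteqP; split=> u /= => [[]|->].
  apply/eqP; rewrite eq_le measure_ge0 andbT leNgt; apply/negP => At_gt0.
  by have : support A t by []; rewrite supp0.
have : (A setT <= \sum_(0 <= n <oo) A [set t | unpickle n = Some t])%E.
  apply: measure_sigma_subadditive => // t _.
  by exists (pickle t) => //=; rewrite pickleK.
by rewrite probability_setT eseries0 ?lee_fin ?ler10// => n _ _; exact: null.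
Qed.

Lemma query_complexity_ge0 A : (0 <= query_complexity A)%E.
Proof.
have [t st] := support_neq0 A.
by apply: (@le_trans _ _ (depth t)%:R%:E); rewrite ?lee_fin// ereal_sup_ubound//;
   exists t.
Qed.

Lemma post_computes_exists eps f : 0 <= eps ->
  exists (A : randomized_dtree R N) (d : nat),
    post_computes eps f A /\ (query_complexity A <= d%:R%:E)%E.
Proof.
move=> eps_ge0.
pose upd (y : cube N) i b : cube N := [ffun j => if j == i then b else y j].
pose full := fix full (s : seq 'I_N) (y : cube N) : dtree N :=
  if s is i :: s' then Query i (full s' (upd y i false)) (full s' (upd y i true))
  else Answer (Some (f y)).
have fullP s : forall x y : cube N, (forall i, i \notin s -> y i = x i) ->
    output (full s y) x = Some (f x).
  elim: s => [|i s IH] x y yx /=.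
    by congr (Some (f _)); apply/ffunP => i; exact: yx.
  case xi : (x i); apply: IH => j js; rewrite ffunE;
    by case: eqVneq => [->|ji]; rewrite ?xi// yx// inE negb_or ji.
pose t := full (enum 'I_N) [ffun=> false].
have tP x : output t x = Some (f x) by apply: fullP => i; rewrite mem_enum.
exists (\d_t : probability (dtree N) R), (depth t); split.
  move=> x answered correct.
  have ta : \d_t answered = 1%E :> \bar R.
    by rewrite diracE mem_set// /answered /= tP.
  have tc : \d_t (correct `&` answered) = 1%E :> \bar R.
    by rewrite diracE mem_set// /answered /correct /= tP.
  split; first by rewrite [ltRHS]ta.
  rewrite /cond_prob [X in fine X / _]tc [X in _ / fine X]ta /= divr1.
  by rewrite lerBlDr lerDl.
apply: ge_ereal_sup => _ [u su <-]; rewrite lee_fin ler_nat.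
suff -> : u = t by [].
apply: contrapT => ut; move: su; rewrite /support /= diracE memNset ?ltxx//=.
exact/nesym.
Qed.

Lemma PostR_min eps f : 0 <= eps ->
  exists2 A : randomized_dtree R N,
    post_computes eps f A & query_complexity A = PostR eps f.
Proof.
move=> eps_ge0.
pose Q (d : nat) := `[< exists2 A : randomized_dtree R N,
  post_computes eps f A & (query_complexity A <= d%:R%:E)%E >].
have exQ : exists d, Q d.
  by have [A [d [Af Ad]]] := post_computes_exists f eps_ge0; exists d;
     apply/asboolP; exists A.
case: (ex_minnP exQ) => d /asboolP[A Af Ad] dmin.
exists A => //; apply/eqP; rewrite eq_le; apply/andP; split; last first.
  by apply: ereal_inf_lbound; exists A.
apply: le_ereal_inf_tmp => _ [B Bf <-].
case E : (query_complexity B) => [r| |]; last 2 first.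
- by rewrite leey.
- by have := query_complexity_ge0 B; rewrite E.
have r_ge0 : 0 <= r by have := query_complexity_ge0 B; rewrite E lee_fin.
apply: (le_trans Ad).
have Qr : Q (Num.truncn r).
  apply/asboolP; exists B => //; apply: ge_ereal_sup => _ [t st <-].
  rewrite lee_fin ler_nat truncn_ge_nat// -lee_fin -E.
  by apply: ereal_sup_ubound; exists t.
rewrite lee_fin; apply: (@le_trans _ _ (Num.truncn r)%:R).
  by rewrite ler_nat dmin.
by rewrite truncn_le.
Qed.

End PostSelection.

(* Main.v *)
(** Let [m = N./2] and suppose that every tree in the support of the
    distribution has depth at most [d].  On an input [x] of weight [m + 1] a
    tree leaves at least [m + 1 - d] ones of [x] unqueried, and turning such a
    one into a zero does not change its output.  Counting these flips, the
    total probabilities [S_b k] of the answer [b] over the inputs of weight [k]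
    satisfy [(m + 1 - d) S_1 (m + 1) <= (N - m) S_1 m], and symmetrically
    [(N - m - d) S_0 m <= (m + 1) S_0 (m + 1)].  Correctness gives
    [S_1 m <= r S_0 m] and [S_0 (m + 1) <= r S_1 (m + 1)] with
    [r = eps / (1 - eps)], so multiplying all four yields
    [(N / 2 - d)^2 <= r^2 (N / 2 + 1)^2].  Hence
    [d >= N / 2 - r (N / 2 + 1)], which is enough since [r <= sqrt r]. *)
Require Import Defs.
From mathcomp Require Import all_boot all_order all_algebra.
From mathcomp Require Import all_classical all_reals all_analysis.
From mathcomp Require Import lra zify.
Set Implicit Arguments.
Unset Strict Implicit.
Unset Printing Implicit Defensive.
Import Order.TTheory GRing.Theory Num.Theory.
Import numFieldNormedType.Exports.
Local Open Scope classical_set_scope.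
Local Open Scope ring_scope.

(** * Bit flips and layers of the cube *)

Definition flip (N : nat) (i : 'I_N) (x : cube N) : cube N :=
  [ffun j => x j (+) (j == i)].

Lemma flipK (N : nat) (i : 'I_N) : involutive (flip i).
Proof. by move=> x; apply/ffunP => j; rewrite !ffunE addbK. Qed.

(** Only coordinates queried on the path of [x] can matter: flipping any [j] other than the root
    coordinate [i] stays in the branch of [x], so each query adds at most one sensitive
    coordinate. *)
Lemma card_sensitive_le_depth (N : nat) (t : dtree N) (x : cube N) :
  (#|[set i | output t (flip i x) != output t x]%SET| <= depth t)%N.
Proof.
elim: t => [ans|i t0 IH0 t1 IH1] /=.
  rewrite (_ : finset _ = finset.set0) ?cards0//.
  by apply/setP => i; rewrite !inE eqxx.
set t := if x i then t1 else t0.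
have IH : (#|[set j | output t (flip j x) != output t x]%SET|
    <= maxn (depth t0) (depth t1))%N.
  rewrite /t leq_max; case: (x i); first by rewrite IH1 orbT.
  by rewrite IH0.
apply: leq_trans (IH : (_.+1 <= _.+1)%N).
rewrite -add1n -(cards1 i); apply: leq_trans (leq_card_setU _ _).
apply/subset_leq_card/fintype.subsetP => j; rewrite !inE ffunE.
case: (eqVneq j i) => //= _; rewrite addbF /t.
by case: (x i).
Qed.

(** The parameter [b] lets a single double count serve both ones and zeros. *)
Definition bit_count (N : nat) (b : bool) (x : cube N) : nat :=
  #|[set i | x i == b]%SET|.

Lemma bit_count_flip (N : nat) (b : bool) (i : 'I_N) (x : cube N) :
  x i != b -> bit_count b (flip i x) = (bit_count b x).+1.
Proof.
move=> xi; rewrite /bit_count (cardsD1 i) !inE ffunE eqxx addbT.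
have -> : ~~ x i == b by move: xi; case: (x i) b => [] [].
congr (_.+1); apply: eq_card => j; rewrite !inE ffunE.
case: (eqVneq j i) => [->|] /=; first exact/esym/negbTE.
by rewrite addbF.
Qed.

Lemma bit_countC (N : nat) (b : bool) (x : cube N) :
  (bit_count b x + bit_count (~~ b) x = N)%N.
Proof.
rewrite -[RHS]card_ord -(cardsC [set i | x i == b]%SET); congr (_ + _)%N.
by apply: eq_card => i; rewrite !inE; case: (x i) b => [] [].
Qed.

Lemma bit_count_surj (N k : nat) : (k <= N)%N ->
  exists x : cube N, bit_count true x = k.
Proof.
move=> kN; exists [ffun i : 'I_N => (i < k)%N].
rewrite /bit_count -sum1dep_card.
under eq_bigl do rewrite ffunE eqb_id.
by rewrite -(big_ord_widen _ (fun=> 1%N) kN) sum1_card card_ord.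
Qed.

(* Double counting of the pairs [(x, i)] with [x i = b] such that [t] outputs
   [o] on [flip i x]. *)
Lemma sum_output_succ (R : realType) (N : nat) (t : dtree N) (d : R)
    (b : bool) (o : option bool) (k : nat) :
  (depth t)%:R <= d ->
  (k.+1%:R - d) * \sum_(x : cube N | bit_count b x == k.+1) (output t x == o)%:R
    <= (N - k)%:R * \sum_(x : cube N | bit_count b x == k) (output t x == o)%:R.
Proof.
move=> td.
apply: (@le_trans _ _ (\sum_(x : cube N | bit_count b x == k.+1)
    \sum_(i | x i == b) (output t (flip i x) == o)%:R)).
  (* If [t] outputs [o] on [x], at most [depth t] of the [k.+1] coordinates with value [b] are
     sensitive; flipping any other one keeps the output. *)
  rewrite mulr_sumr; apply: ler_sum => x /eqP xk.
  case: (eqVneq (output t x) o) => [xo|_]; last by rewrite mulr0 sumr_ge0.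
  rewrite mulr1 lerBlDr -xk /bit_count.
  rewrite -(cardsID [set i | output t (flip i x) == o]%SET) natrD.
  apply: lerD.
    rewrite -natr_sum ler_nat -sum1dep_card big_mkcondr /=.
    under eq_bigl do rewrite inE.
    by apply: leq_sum => i _; rewrite inE; case: ifP.
  apply: le_trans td; rewrite ler_nat.
  apply: leq_trans (card_sensitive_le_depth t x).
  by apply/subset_leq_card/fintype.subsetP => i; rewrite !inE xo => /andP[].
rewrite (exchange_big_dep xpredT)//= mulr_sumr.
(* Substituting [flip i x] for [x] moves the inner sum down to count [k], with [x i != b]. *)
rewrite (eq_bigr (fun i =>
    \sum_(x : cube N | (bit_count b x == k) && (x i != b))
    (output t x == o)%:R)); last first.
  move=> i _; rewrite (reindex_inj (inv_inj (@flipK N i))) /=.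
  apply: eq_big => [x|x _]; last by rewrite flipK.
  rewrite ffunE eqxx addbT.
  have -> : (~~ x i == b) = (x i != b) by case: (x i) b => [] [].
  case: (boolP (x i == b)) => [|xi]; rewrite ?andbF// !andbT.
  by rewrite bit_count_flip.
rewrite (exchange_big_dep (fun x : cube N => bit_count b x == k)) /=;
    last first.
  by move=> i x _ /andP[].
apply: ler_sum => x /eqP xk; rewrite xk eqxx /=.
(* Each [x] now occurs once for each of its [N - k] coordinates different from [b]. *)
rewrite sumr_const -[leLHS]mulr_natl ler_wpM2r// ler_nat.
have -> : (N - k = bit_count (~~ b) x)%N.
  by rewrite -xk -[X in (X - _)%N](bit_countC b x) addKn.
rewrite /bit_count -sum1dep_card -sum1_card.
by apply/eq_leq/eq_bigl => i; rewrite unfold_in; case: (x i); case: (b).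
Qed.

(** * Averaging over the random tree *)

Lemma measure_setC_support (R : realType) (N : nat)
    (A : randomized_dtree R N) : A (~` Defs.support A) = 0%E.
Proof.
(* Trees are countable: [F n] contains at most the tree with code [n], and only if that tree has
   mass zero. *)
pose F (n : nat) := ~` Defs.support A `&` [set t | unpickle n = Some t].
have null n : A (F n) = 0%E.
  case E : (unpickle n) => [t|]; last first.
    rewrite (_ : F n = set0) ?measure0//; apply/seteqP; split=> // u.
    by rewrite /F /= E => -[].
  have [st|st] := pselect (Defs.support A t).
    rewrite (_ : F n = set0) ?measure0//; apply/seteqP; split=> // u.
    by rewrite /F /= E => -[su [tu]]; apply: su; rewrite -tu.
  apply/eqP; rewrite eq_le measure_ge0 andbT.
  apply: (@le_trans _ _ (A [set t])).
    by apply: le_measure; rewrite ?inE// => u; rewrite /F /= E => -[_ [->]].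
  by rewrite leNgt; apply/negP.
apply/eqP; rewrite eq_le measure_ge0 andbT.
have -> : 0%E = (\sum_(0 <= n <oo) A (F n))%E :> \bar R.
  by rewrite eseries0.
apply: measure_sigma_subadditive => // t st.
by exists (pickle t) => //; split=> //=; rewrite pickleK.
Qed.

Lemma ae_support (R : realType) (N : nat) (A : randomized_dtree R N) :
  \forall t \ae A, Defs.support A t.
Proof.
by exists (~` Defs.support A); split=> //; exact: measure_setC_support.
Qed.

Lemma sum_prob_output (R : realType) (N : nat) (A : randomized_dtree R N)
    (P : pred (cube N)) (o : option bool) (c : R) : 0 <= c ->
  (\int[A]_t (c * \sum_(x | P x) (output t x == o)%:R)%:E =
   (c * \sum_(x | P x) fine (A [set t | output t x = o]))%:E)%E.
Proof.
move=> c0.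
under eq_integral do rewrite EFinM -sumEFin.
rewrite ge0_integralZl_EFin//; last first.
  by move=> t _; rewrite sume_ge0// => x _; rewrite lee_fin.
rewrite EFinM; congr (_ * _)%E; rewrite -sumEFin.
under eq_integral do rewrite -big_filter.
rewrite ge0_integral_sum//.
rewrite big_filter; apply: eq_bigr => x _.
rewrite fineK ?fin_num_measure//.
rewrite -[X in _ = A X]setIT -(integral_indic A)//.
apply: eq_integral => t _; rewrite indicE; congr (_%:R%:E); congr nat_of_bool.
by apply/idP/idP => [/eqP ?|]; rewrite ?inE// => /= ->.
Qed.

(** Integrates [sum_output_succ]. The depth bound holds on the support, hence almost everywhere;
    [d <= k.+1] keeps the integrands nonnegative. *)
Lemma sum_prob_succ (R : realType) (N : nat) (A : randomized_dtree R N) (d : R)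
    (b : bool) (o : option bool) (k : nat) :
  (query_complexity A <= d%:E)%E -> d <= k.+1%:R ->
  (k.+1%:R - d) *
      \sum_(x : cube N | bit_count b x == k.+1)
        fine (A [set t | output t x = o])
    <= (N - k)%:R *
      \sum_(x : cube N | bit_count b x == k)
        fine (A [set t | output t x = o]).
Proof.
move=> Ad dk; rewrite -lee_fin -!sum_prob_output ?subr_ge0//.
apply: ae_ge0_le_integral => //.
- by move=> t _; rewrite lee_fin mulr_ge0 ?subr_ge0// sumr_ge0.
- by move=> t _; rewrite lee_fin mulr_ge0// sumr_ge0.
have := @ae_support _ _ A; apply: filterS => t st _; rewrite lee_fin.
apply: sum_output_succ; rewrite -lee_fin; apply: le_trans Ad.
by apply: ereal_sup_ubound; exists t.
Qed.

(** * Post-selected correctness and the bound for majority *)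

Lemma post_computes_prob (R : realType) (N : nat) (A : randomized_dtree R N)
    (f : cube N -> bool) (eps : R) (x : cube N) :
  eps < 1 -> post_computes eps f A ->
  let p b := fine (A [set t | output t x = Some b]) in
  0 < p (f x) /\ (1 - eps) * p (~~ f x) <= eps * p (f x).
Proof.
move=> eps1 /(_ x); set D := [set t | _ <> _]; set C := [set t | _ = _].
move=> -[D0]; rewrite /cond_prob.
have -> : C `&` D = C.
  by apply/seteqP; split=> [t []//|t Ct]; split; rewrite // /D /= Ct.
pose p b := fine (A [set t | output t x = Some b]).
rewrite -!/(p _) => le.
(* An answer is either right or wrong, so the condition becomes linear in [p]. *)
have pE : fine (A D) = p (f x) + p (~~ f x).
  rewrite /p -fineD ?fin_num_measure// -measureU//.
    congr (fine (A _)); apply/seteqP; split=> t; rewrite /D /=.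
      by case: (output t x) => [[]|] //= _; case: (f x); auto.
    by case=> ->.
  by apply/seteqP; split=> // t [/= ->] []; case: (f x).
have D0' : 0 < fine (A D).
  by rewrite fine_gt0// D0 ltey_eq fin_num_measure.
move: le; rewrite ler_pdivlMr// pE -/(p (f x)) => le.
have p0 : 0 <= p (~~ f x) by rewrite fine_ge0.
split; last by lra.
(* If [p (f x)] were not positive, [le] would make the probability of answering at most 0. *)
by rewrite pE in D0'; nra.
Qed.

Lemma post_computes_MAJ_bound (R : realType) (N : nat)
    (A : randomized_dtree R N) (eps d : R) :
  0 <= eps < 1 -> (0 < N)%N -> post_computes eps (@MAJ N) A ->
  (query_complexity A <= d%:E)%E -> d <= N%:R / 2 ->
  (1 - eps) ^+ 2 * (N%:R / 2 - d) ^+ 2 <= eps ^+ 2 * (N%:R / 2 + 1) ^+ 2.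
Proof.
move=> /andP[eps0 eps1] N0 Af Ad dN.
set m := N./2.
have mN : (m < N)%N by rewrite /m; lia.
have m2 : (m + m <= N <= (m + m).+1)%N by rewrite /m; lia.
have NmE : (N - m = (N - m.+1).+1)%N by lia.
(* For either parity of [N], both [m.+1] and [N - m] lie between [N / 2] and [N / 2 + 1]. *)
have m_bounds : [/\ N <= m.+1 * 2, N <= (N - m) * 2, m * 2 <= N
    & (N - m) * 2 <= N + 2]%N by split; lia.
pose S b (k : nat) := \sum_(x : cube N | bit_count true x == k)
  fine (A [set t | output t x = Some b]).
have falseE k : (k <= N)%N -> \sum_(x : cube N | bit_count false x == (N - k)%N)
    fine (A [set t | output t x = Some false]) = S false k.
  move=> kN; apply: eq_bigl => x; have := bit_countC true x => /= E.
  by apply/eqP/eqP; lia.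
have MAJE (x : cube N) : MAJ x = (N < 2 * bit_count true x)%N.
  rewrite /MAJ /hamming_weight /bit_count; congr (_ < 2 * _)%N.
  by apply: eq_card => i; rewrite !inE eqb_id.
(* The pointwise guarantee is summed over a layer where [MAJ] is constant. The layer is nonempty, so
   [S b k] is positive and can be cancelled later. *)
have key k b : (k <= N)%N ->
    (forall x : cube N, bit_count true x = k -> MAJ x = b) ->
    0 < S b k /\ (1 - eps) * S (~~ b) k <= eps * S b k.
  move=> kN kb; split.
    have [x xk] := bit_count_surj kN.
    rewrite /S (bigD1 x) ?xk ?eqxx//=; apply: ltr_pwDl.
      by have [+ _] := post_computes_prob x eps1 Af; rewrite kb.
    by apply: sumr_ge0 => y _; rewrite fine_ge0.
  rewrite /S !mulr_sumr; apply: ler_sum => x /eqP xk.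
  by have [_] := post_computes_prob x eps1 Af; rewrite kb.
have [Sf0 Sf] : 0 < S false m /\
    (1 - eps) * S true m <= eps * S false m.
  by apply: (key m false) => [|x xm]; [lia|rewrite MAJE; lia].
have [St0 St] : 0 < S true m.+1 /\
    (1 - eps) * S false m.+1 <= eps * S true m.+1.
  by apply: (key m.+1 true) => [|x xm]; [lia|rewrite MAJE; lia].
have [mR NmR mR' NmR'] : [/\ N%:R / 2 <= m.+1%:R :> R,
    N%:R / 2 <= (N - m)%:R :> R, m.+1%:R <= N%:R / 2 + 1 :> R &
    (N - m)%:R <= N%:R / 2 + 1 :> R].
  case: m_bounds; rewrite -!(ler_nat R) !natrM natrD -(natr1 m) => *.
  by split; lra.
have up := @sum_prob_succ R N A d true (Some true) m Ad (le_trans dN mR).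
(* Complementing the bits, weight [k] becomes [N - k] zeros. *)
have := @sum_prob_succ R N A d false (Some false) (N - m.+1) Ad.
rewrite -NmE !falseE ?(ltnW mN)// => /(_ (le_trans dN NmR)).
rewrite subKn// -/(S true m) => down.
rewrite -/(S true m.+1) -/(S true m) in up.
have S0 b k : 0 <= S b k by apply: sumr_ge0 => x _; rewrite fine_ge0.
(* Multiply [up] by [down], then use [Sf] and [St] to replace
   [S true m * S false m.+1] by [S false m * S true m.+1] and cancel it. *)
have prod : (1 - eps) ^+ 2 * ((m.+1%:R - d) * ((N - m)%:R - d)) <=
    eps ^+ 2 * ((N - m)%:R * m.+1%:R).
  rewrite -(ler_pM2r (mulr_gt0 Sf0 St0)).
  have e1 : 0 <= 1 - eps by rewrite subr_ge0 ltW.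
  have h1 : (m.+1%:R - d) * S true m.+1 * (((N - m)%:R - d) * S false m)
      <= (N - m)%:R * S true m * (m.+1%:R * S false m.+1).
    by apply: ler_pM => //; rewrite mulr_ge0 ?S0// subr_ge0;
      [apply: le_trans mR|apply: le_trans NmR].
  have h2 : (1 - eps) * S true m * ((1 - eps) * S false m.+1)
      <= eps * S false m * (eps * S true m.+1).
    by apply: ler_pM => //; rewrite mulr_ge0 ?S0.
  have h1' := ler_wpM2l (sqr_ge0 (1 - eps)) h1.
  have h2' := ler_wpM2l (mulr_ge0 (ler0n R (N - m)) (ler0n R m.+1)) h2.
  lra.
have d' : 0 <= N%:R / 2 - d by rewrite subr_ge0.
apply: (@le_trans _ _ ((1 - eps) ^+ 2 *
    ((m.+1%:R - d) * ((N - m)%:R - d)))).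
  by rewrite ler_wpM2l ?sqr_ge0// expr2 ler_pM// lerD2r.
apply: (le_trans prod); rewrite ler_wpM2l ?sqr_ge0// expr2.
by rewrite ler_pM.
Qed.

Theorem theorem6 (R : realType) (eps : R) (eps_gt0 : 0 < eps)
    (eps_lt_half : eps < 1 / 2) :
  exists o : nat -> R,
    o @ \oo --> (0 : R) /\
    forall N : nat,
      ((N%:R / 2 * (1 - Num.sqrt (eps / (1 - eps)) * (1 + o N)))%:E
         <= PostR eps (@MAJ N))%E.
Proof.
(* Here [o N] is [4 / (N + 1)], so that [N / 2 * o N >= 1] for [N >= 1]; this absorbs the [+ 1] in
   [N / 2 + 1]. *)
exists (fun N => 4 * harmonic N); split.
  by rewrite -[X in _ --> X](mulr0 (4 : R)); apply: cvgM;
    [exact: cvg_cst|exact: cvg_harmonic].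
move=> N; apply: le_ereal_inf_tmp => _ [A Af <-].
have [N_eq0|N0] := posnP N.
  rewrite [in leLHS](_ : N%:R / 2 = 0) ?mul0r ?query_complexity_ge0//.
  by rewrite N_eq0 mul0r.
case E : (query_complexity A) => [d| |]; last 2 first.
- by rewrite leey.
- by have := query_complexity_ge0 A; rewrite E.
rewrite lee_fin.
have e1 : 0 < 1 - eps by lra.
set r := eps / (1 - eps); set s := Num.sqrt r.
have r0 : 0 <= r by rewrite divr_ge0// ltW.
have r1 : r <= 1 by rewrite ler_pdivrMr//; lra.
have rs : r <= s.
  by rewrite -{1}(sqr_sqrtr r0) -/s expr2 ler_piMl ?sqrtr_ge0//
    -sqrtr1 ler_wsqrtr.
have NoN : 1 <= N%:R / 2 * (4 * harmonic N) :> R.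
  rewrite /harmonic /= mulrA ler_pdivlMr ?ltr0n// mul1r -natr1.
  have : 1 <= N%:R :> R by rewrite ler1n.
  lra.
apply: (@le_trans _ _ (N%:R / 2 - s * (N%:R / 2 + 1))).
  rewrite mulrBr mulr1 lerD2l lerN2 mulrCA ler_wpM2l ?sqrtr_ge0//.
  by rewrite mulrDr mulr1 lerD2l.
apply: (@le_trans _ _ (N%:R / 2 - r * (N%:R / 2 + 1))).
  by rewrite lerD2l lerN2 ler_wpM2r// addr_ge0// divr_ge0.
(* Above [N / 2] the bound is immediate; below, both squared bases are nonnegative and the squares
   can be removed. *)
have [dN|Nd] := leP d (N%:R / 2); last first.
  apply: (le_trans _ (ltW Nd)).
  by rewrite gerBl mulr_ge0// addr_ge0// divr_ge0.
have eps01 : 0 <= eps < 1 by apply/andP; split; lra.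
have Ad : (query_complexity A <= d%:E)%E by rewrite E.
have := post_computes_MAJ_bound eps01 N0 Af Ad dN.
rewrite -!exprMn ler_pXn2r// ?nnegrE; last 2 first.
- by rewrite mulr_ge0 ?subr_ge0//; lra.
- by rewrite mulr_ge0 ?addr_ge0 ?divr_ge0// ltW.
rewrite mulrC -ler_pdivlMr// mulrAC -/r; lra.
Qed.
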